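(* For every $\delta$ with $0\le\delta<1$, the function $w(x)/|x|^{\delta}$ (extended by $0$ at the origin) is a viscosity solution in the unit ball $B\subset\mathbf{R}^{12}$ of a uniformly elliptic Isaacs equation $F(D^2u)=\sup_b\inf_a L_{ab}u=0$.
   Context: $B=\{x\in\mathbf{R}^{12}:|x|<1\}$. Identify $\mathbf{R}^{12}$ with $\mathbf{H}^3$, where $\mathbf{H}$ is the algebra of Hamilton quaternions, identified with $\mathbf{R}^4$ via $(t_0,t_1,t_2,t_3)\mapsto t_0+t_1i+t_2j+t_3k$. For $x=(q_1,q_2,q_3)\in\mathbf{H}^3$ set $w(x)=\mathrm{Re}(q_1q_2q_3)/|x|$ for $x\ne0$, and $w(0)=0$. A uniformly elliptic Isaacs equation (in simple homogeneous form) in $\mathbf{R}^n$ is an equation $F(D^2u)=\sup_b\inf_a L_{ab}u=0$, where $L_{ab}$ is a family, depending on two parameters $a,b$ (ranging over some index sets), of linear uniformly elliptic operators $L_{ab}u=\mathrm{Tr}(A_{ab}D^2u)$ with constant symmetric coefficient matrices $A_{ab}$, all with a common ellipticity constant $C>0$: $C^{-1}|\xi|^2\le {}^t\xi A_{ab}\xi\le C|\xi|^2$ for all $\xi\in\mathbf{R}^n$ and all $a,b$. A continuous function $u$ on an open set $\Omega$ is a viscosity solution of $F(D^2u)=0$ in $\Omega$ if for every $x_0\in\Omega$ and every $C^2$ function $\varphi$ near $x_0$: $F(D^2\varphi(x_0))\ge0$ whenever $u-\varphi$ has a local maximum at $x_0$, and $F(D^2\varphi(x_0))\le0$ whenever $u-\varphi$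 has a local minimum at $x_0$. *)

(* Defs.v *)
From HB Require Import structures.
From mathcomp Require Import all_boot all_order all_algebra.
From mathcomp Require Import all_classical all_reals all_analysis.
From mathcomp Require Import ring.

Set Implicit Arguments.
Unset Strict Implicit.
Unset Printing Implicit Defensive.

Import Order.TTheory GRing.Theory Num.Theory.
Import numFieldNormedType.Exports.

Local Open Scope classical_set_scope.
Local Open Scope ring_scope.

(* The library norm on 'rV[R]_n.+1 is the sup norm; it induces the usual
   topology, but |x| in the statement is the Euclidean norm. *)
Definition enorm (R : realType) (n : nat) (x : 'rV[R]_n) : R :=
  Num.sqrt (\sum_(i < n) x 0 i ^+ 2).

Definition unit_ball (R : realType) (n : nat) : set 'rV[R]_n :=
  [set x | enorm x < 1].

Definition partial (R : realType) (n : nat) (i : 'I_n.+1)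
    (f : 'rV[R]_n.+1 -> R) : 'rV[R]_n.+1 -> R :=
  fun x => 'D_(delta_mx 0 i) f x.

Definition hessian (R : realType) (n : nat) (f : 'rV[R]_n.+1 -> R)
    (x : 'rV[R]_n.+1) : 'M[R]_n.+1 :=
  \matrix_(i, j) partial i (partial j f) x.

(* 'D_v is a total operator, hence the explicit derivability conditions. *)
Definition C2_near (R : realType) (n : nat) (f : 'rV[R]_n.+1 -> R)
    (x0 : 'rV[R]_n.+1) : Prop :=
  \forall y \near x0,
    [/\ {for y, continuous f},
        forall i, derivable f y (delta_mx 0 i)
                  /\ {for y, continuous (partial i f)} &
        forall i j, derivable (partial j f) y (delta_mx 0 i)
                    /\ {for y, continuous (partial i (partial j f))}].

Definition local_max (R : realType) (n : nat) (f : 'rV[R]_n.+1 -> R)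
    (x0 : 'rV[R]_n.+1) : Prop := \forall y \near x0, f y <= f x0.

Definition local_min (R : realType) (n : nat) (f : 'rV[R]_n.+1 -> R)
    (x0 : 'rV[R]_n.+1) : Prop := \forall y \near x0, f x0 <= f y.

Definition viscosity_solution (R : realType) (n : nat)
    (F : 'M[R]_n.+1 -> R) (Omega : set 'rV[R]_n.+1)
    (u : 'rV[R]_n.+1 -> R) : Prop :=
  {within Omega, continuous u} /\
  forall (x0 : 'rV[R]_n.+1) (phi : 'rV[R]_n.+1 -> R),
    Omega x0 -> C2_near phi x0 ->
    (local_max (fun y => u y - phi y) x0 -> 0 <= F (hessian phi x0)) /\
    (local_min (fun y => u y - phi y) x0 -> F (hessian phi x0) <= 0).

Definition uniformly_elliptic (R : realType) (n : nat) (IA IB : Type)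
    (A : IA -> IB -> 'M[R]_n) (C : R) : Prop :=
  forall a b, (A a b)^T = A a b /\
    forall xi : 'rV[R]_n,
      C^-1 * enorm xi ^+ 2 <= (xi *m A a b *m xi^T) 0 0 <= C * enorm xi ^+ 2.

(* The index sets are nonempty and the family is bounded when it is uniformly
   elliptic, so the real-valued sup and inf are the genuine ones. *)
Definition isaacs_operator (R : realType) (n : nat) (IA IB : Type)
    (A : IA -> IB -> 'M[R]_n) (M : 'M[R]_n) : R :=
  sup [set inf [set \tr (A a b *m M) | a in [set: IA]] | b in [set: IB]].

Definition uniformly_elliptic_isaacs (R : realType) (n : nat)
    (F : 'M[R]_n -> R) : Prop :=
  exists (IA IB : Type) (A : IA -> IB -> 'M[R]_n) (C : R),
    [/\ inhabited IA, inhabited IB, 0 < C, uniformly_elliptic A C &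
        F = isaacs_operator A].

Record quaternion (R : realType) : Type :=
  Quaternion { q_re : R; q_i : R; q_j : R; q_k : R }.

Definition qmul (R : realType) (p q : quaternion R) : quaternion R :=
  let: Quaternion a b c d := p in
  let: Quaternion a' b' c' d' := q in
  Quaternion (a * a' - b * b' - c * c' - d * d')
             (a * b' + b * a' + c * d' - d * c')
             (a * c' - b * d' + c * a' + d * b')
             (a * d' + b * c' - c * b' + d * a').

Lemma qmulA (R : realType) : associative (@qmul R).
Proof. by move=> [? ? ? ?] [? ? ? ?] [? ? ? ?] /=; congr Quaternion; ring. Qed.

(* The m-th block (m = 0, 1, 2) of four consecutive coordinates of x in
   R^12 = H^3. *)
Definition qblock (R : realType) (x : 'rV[R]_12) (m : nat) : quaternion R :=
  Quaternion (x 0 (inord (4 * m))) (x 0 (inord (4 * m + 1)))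
             (x 0 (inord (4 * m + 2))) (x 0 (inord (4 * m + 3))).

Definition w (R : realType) (x : 'rV[R]_12) : R :=
  if x == 0 then 0
  else q_re (qmul (qmul (qblock x 0) (qblock x 1)) (qblock x 2)) / enorm x.

Definition w_delta (R : realType) (delta : R) (x : 'rV[R]_12) : R :=
  if x == 0 then 0 else w x / (enorm x `^ delta).

(* Main.v *)
Require Import Defs.
From mathcomp Require Import all_boot all_order all_algebra.
From mathcomp Require Import all_classical all_reals all_analysis.
From mathcomp Require Import ring lra.
Import Order.TTheory GRing.Theory Num.Theory.
Import numFieldNormedType.Exports.

Set Implicit Arguments.
Unset Strict Implicit.
Unset Printing Implicit Defensive.

(** Write u = P / |x|^m with P = Re(q1 q2 q3), h = P / |x|^2 and m = 1 + delta,
    so that 1 <= m < 2, and let N(x) be the Hessian of u at x <> 0. A real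
    matrix A = eps I + B with B >= 0, tr B = 1 and B x = 0 satisfies, up to a
    positive factor,
      tr(A N(x)) = tr(B D^2P(x)) - m P(x)/|x|^2 - eps m (16 - m) P(x)/|x|^2,
    and for eps = (2 - m) / (m (16 - m)) this is tr(B D^2P(x)) - 2 h(x).
    The Isaacs operator is indexed by pairs (x, y) of points: it suffices to
    find B annihilating x and y with tr(B D^2P(x)) <= 2 h(x) and
    tr(B D^2P(y)) >= 2 h(y), since then the value of the operator at every N(x)
    is 0.
    Such a B exists. For every p <> 0 and every xi, quaternion algebra provides
    three vectors orthogonal to p and xi whose B satisfies
    tr(B D^2P(z)) = 2 dh(p)(z) for all z. Along the segment from x to y the
    function h minus its linear interpolation vanishes at both ends, hence it
    has a zero p where it is nondecreasing; there dh(p)(x) <= h(x) and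
    dh(p)(y) >= h(y).
    At the origin only the oddness of u is used. *)

Local Open Scope classical_set_scope.
Local Open Scope ring_scope.

(** * Quaternions *)

Section Quaternions.
Variable R : realType.
Implicit Types p q z : quaternion R.

Definition qconj q := Quaternion (q_re q) (- q_i q) (- q_j q) (- q_k q).
Definition qscale (a : R) q :=
  Quaternion (a * q_re q) (a * q_i q) (a * q_j q) (a * q_k q).
Definition qdot p q :=
  q_re p * q_re q + q_i p * q_i q + q_j p * q_j q + q_k p * q_k q.
Definition qtri p q z := q_re (qmul (qmul p q) z).
Definition qim (a b c : R) := Quaternion 0 a b c.

Lemma qtri_cyc p q z : qtri p q z = qtri q z p.
Proof. case: p => ????; case: q => ????; case: z => ????; rewrite /qtri /=;
  ring. Qed.

Lemma qdotC p q : qdot p q = qdot q p.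
Proof. rewrite /qdot; ring. Qed.

Lemma qdot_scalel a p q : qdot (qscale a p) q = a * qdot p q.
Proof. rewrite /qdot/=; ring. Qed.

Lemma qdot_mul p q : qdot (qmul p q) (qmul p q) = qdot p p * qdot q q.
Proof. case: p => ????; case: q => ????; rewrite /qdot/=; ring. Qed.

Lemma qmul_scalel a p q : qmul (qscale a p) q = qscale a (qmul p q).
Proof. by case: p => ????; case: q => ????; congr Quaternion; rewrite /=;
  ring. Qed.

Lemma qmul_scaler a p q : qmul p (qscale a q) = qscale a (qmul p q).
Proof. by case: p => ????; case: q => ????; congr Quaternion; rewrite /=;
  ring. Qed.

Lemma q_re_scale a p : q_re (qscale a p) = a * q_re p.
Proof. by []. Qed.

(** Two linear conditions on three unknowns leave a nonzero solution, which is then normalised. It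
    supplies an imaginary unit quaternion. *)
Lemma orthogonal_unit3 (a1 a2 a3 b1 b2 b3 : R) : exists m1 m2 m3 : R,
  [/\ m1 ^+ 2 + m2 ^+ 2 + m3 ^+ 2 = 1,
      m1 * a1 + m2 * a2 + m3 * a3 = 0 & m1 * b1 + m2 * b2 + m3 * b3 = 0].
Proof.
pose A : 'M[R]_(3, 2) := \matrix_(i, j)
  (if j == 0 then [:: a1; a2; a3] else [:: b1; b2; b3])`_i.
have kA : kermx A != 0.
  rewrite -mxrank_eq0 mxrank_ker subn_eq0 -ltnNge.
  by rewrite (leq_ltn_trans (rank_leq_col A)).
pose m := nz_row (kermx A).
have m0 : m != 0 by rewrite nz_row_eq0.
have mA : m *m A = 0 by apply/sub_kermxP; exact: nz_row_sub.
pose s := m 0 0 ^+ 2 + m 0 1 ^+ 2 + m 0 2 ^+ 2.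
have s0 : 0 < s.
  rewrite lt_neqAle !addr_ge0 ?sqr_ge0// andbT eq_sym;
    apply: contra m0 => /eqP se.
  have [e0 e1 e2] : [/\ m 0 0 = 0, m 0 1 = 0 & m 0 2 = 0].
    by rewrite /s in se; split; nra.
  by apply/eqP/rowP => -[[|[|[|//]]] i]; rewrite mxE;
    [rewrite -[RHS]e0|rewrite -[RHS]e1|rewrite -[RHS]e2];
    congr (m _ _); apply/val_inj.
have eA j : m 0 0 * A 0 j + m 0 1 * A 1 j + m 0 2 * A 2 j = 0.
  move/rowP/(_ j) : mA; rewrite !mxE !big_ord_recr big_ord0 /= add0r => mAj.
  rewrite -[RHS]mAj; congr (_ + _ + _); congr (_ * _);
    by [congr (m _ _); apply/val_inj|rewrite !mxE].
have := eA 0; have := eA 1; rewrite !mxE/= => eb ea.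
have r0 : Num.sqrt s != 0 by rewrite gt_eqF// sqrtr_gt0.
have rs : Num.sqrt s ^+ 2 = s by rewrite sqr_sqrtr// ltW.
exists (m 0 0 / Num.sqrt s), (m 0 1 / Num.sqrt s), (m 0 2 / Num.sqrt s); split.
- by rewrite !exprMn !exprVn rs -!mulrDl divff// gt_eqF.
- by rewrite -[RHS](mul0r (Num.sqrt s)^-1) -ea; ring.
- by rewrite -[RHS](mul0r (Num.sqrt s)^-1) -eb; ring.
Qed.

(* Such an m satisfies m c = conj(c) m and m^2 = -1. *)
Lemma qmul_anticomm (m1 m2 m3 : R) c :
  m1 ^+ 2 + m2 ^+ 2 + m3 ^+ 2 = 1 -> m1 * q_i c + m2 * q_j c + m3 * q_k c = 0 ->
  qmul (qim m1 m2 m3) (qmul c (qim m1 m2 m3)) = qscale (-1) (qconj c).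
Proof.
(* Writing -1 as [- (m1 ^+ 2 + m2 ^+ 2 + m3 ^+ 2)] turns the components into polynomial identities
   modulo [mc]. *)
case: c => c0 c1 c2 c3 /= mm mc; rewrite /qscale/= -[-1](congr1 -%R mm).
congr Quaternion.
- ring.
- by transitivity ((m1 ^+ 2 + m2 ^+ 2 + m3 ^+ 2) * c1 - 2 * m1 * (m1 * c1 + m2
    * c2 + m3 * c3)); [ring|rewrite mc; ring].
- by transitivity ((m1 ^+ 2 + m2 ^+ 2 + m3 ^+ 2) * c2 - 2 * m2 * (m1 * c1 + m2
    * c2 + m3 * c3)); [ring|rewrite mc; ring].
- by transitivity ((m1 ^+ 2 + m2 ^+ 2 + m3 ^+ 2) * c3 - 2 * m3 * (m1 * c1 + m2
    * c2 + m3 * c3)); [ring|rewrite mc; ring].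
Qed.

(** Twisting p1, p2, p3 by an imaginary unit m makes each block orthogonal to its original. When two
    factors of the triple product are twisted, the two copies of m cancel through m^2 = -1, up to
    sign, except in the first term: there m c m = - conj(c) with c = p1 p2 p3, and conj(c) = 2 Re(c)
    - c yields the correction in [qdot p1 z1]. *)
Lemma qtri_frame p1 p2 p3 x1 x2 x3 : exists v1 v2 v3 : quaternion R,
  [/\ qdot v1 p1 + qdot v2 p2 + qdot v3 p3 = 0,
      qdot v1 x1 + qdot v2 x2 + qdot v3 x3 = 0,
      qdot v1 v1 + qdot v2 v2 + qdot v3 v3 =
        qdot p1 p1 * (qdot p1 p1 + qdot p2 p2 + qdot p3 p3) &
      forall z1 z2 z3,
        qtri z1 v2 v3 + qtri v1 z2 v3 + qtri v1 v2 z3 =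
        qdot p1 p1 * (qtri z1 p2 p3 + qtri p1 z2 p3 + qtri p1 p2 z3)
        - 2 * qtri p1 p2 p3 * qdot p1 z1].
Proof.
pose n := qdot p1 p1.
have n_ge0 : 0 <= n by rewrite /n /qdot -!expr2 !addr_ge0 ?sqr_ge0.
have [n0|n0] := eqVneq n 0.
  have -> : p1 = Quaternion 0 0 0 0.
    move: n0; rewrite /n /qdot; case: p1 {n n_ge0} => a b c d /= n0.
    by congr Quaternion; nra.
  (* For p1 = 0 all four right-hand sides vanish. *)
  exists (Quaternion 0 0 0 0), (Quaternion 0 0 0 0), (Quaternion 0 0 0 0).
  rewrite /qdot /qtri/=; split; try ring.
  by move=> [????] [????] [????] /=; ring.
pose r := Num.sqrt n.
have rr : r ^+ 2 = n by rewrite sqr_sqrtr.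
have r0 : r != 0 by apply: contra n0 => /eqP r0; rewrite -rr r0 expr0n.
pose c := qmul (qmul p1 p2) p3.
(* The factors - r, 1 / r and r give squared lengths n |p1|^2, n |p2|^2 and n |p3|^2. *)
pose v1 m := qscale (- r) (qmul m p1).
pose v2 m := qscale r^-1 (qmul (qconj p1) (qmul m (qmul p1 p2))).
pose v3 m := qscale r (qmul p3 m).
(* Orthogonality to x is a single linear condition on m; the other condition used is orthogonality
   to the imaginary part of c. *)
pose f m := qdot (v1 m) x1 + qdot (v2 m) x2 + qdot (v3 m) x3.
have [m1 [m2 [m3 [mm mc mx]]]] := orthogonal_unit3 (q_i c) (q_j c) (q_k c)
  (f (qim 1 0 0)) (f (qim 0 1 0)) (f (qim 0 0 1)).
pose m := qim m1 m2 m3.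
have m_m : qdot m m = 1 by rewrite /qdot/= -[RHS]mm; ring.
have mK x : qmul m (qmul m x) = qscale (-1) x.
  rewrite /m; case: x => a b d e; rewrite /qscale/= -[-1](congr1 -%R mm).
  by congr Quaternion; ring.
have pK x : qmul p1 (qmul (qconj p1) x) = qscale n x.
  rewrite /n; case: (p1) => ????; case: x => ????; rewrite /qscale /qdot/=.
  by congr Quaternion; ring.
exists (v1 m), (v2 m), (v3 m); split.
- rewrite /v1 /v2 /v3 !qdot_scalel.
  have -> : qdot (qmul m p1) p1 = 0 by rewrite /m; case: (p1) => ????;
    rewrite /qdot/=; ring.
  have -> : qdot (qmul p3 m) p3 = 0 by rewrite /m; case: (p3) => ????;
    rewrite /qdot/=; ring.
  have -> : qdot (qmul (qconj p1) (qmul m (qmul p1 p2))) p2 = 0.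
    by rewrite /m; case: (p1) => ????; case: (p2) => ????; rewrite /qdot/=;
      ring.
  ring.
- rewrite -[LHS]/(f m); have -> : f m
    = m1 * f (qim 1 0 0) + m2 * f (qim 0 1 0) + m3 * f (qim 0 0 1).
    rewrite /f /m /v1 /v2 /v3 !qdot_scalel.
    case: (p1) => ????; case: (p2) => ????; case: (p3) => ????.
    by rewrite /qdot/=; ring.
  by [].
- rewrite /v1 /v2 /v3 !qdot_scalel ![qdot _ (qscale _ _)]qdotC !qdot_scalel
    !qdot_mul m_m.
  have -> : qdot (qconj p1) (qconj p1) = n by rewrite /n /qdot/=; ring.
  by rewrite -/n -rr; field.
- move=> z1 z2 z3; rewrite -/n.
  have -> : qtri z1 (v2 m) (v3 m) = n * qtri z1 p2 p3 - 2 * q_re c * qdot p1 z1.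
    transitivity (q_re (qmul (qmul z1 (qconj p1)) (qmul m (qmul c m)))).
      rewrite /v2 /v3 /c /qtri !(qmul_scaler, qmul_scalel) !q_re_scale !qmulA.
      by rewrite mulVKf.
    rewrite qmul_anticomm// /c /n.
    case: (z1) => ????; case: (p1) => ????; case: (p2) => ????;
      case: (p3) => ????.
    by rewrite /qdot /qtri/=; ring.
  have -> : qtri (v1 m) z2 (v3 m) = n * qtri p1 z2 p3.
    (* Cycling puts v3 before v1, so that the two copies of m meet and multiply to -1. *)
    rewrite -rr qtri_cyc qtri_cyc [in RHS]qtri_cyc [in RHS]qtri_cyc.
    rewrite /v1 /v2 /v3 /qtri !(qmul_scaler, qmul_scalel) !q_re_scale.
    rewrite -(qmulA p3) mK !(qmul_scaler, qmul_scalel) !q_re_scale.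
    by rewrite expr2; ring.
  have -> : qtri (v1 m) (v2 m) z3 = n * qtri p1 p2 z3.
    rewrite /v1 /v2 /qtri !(qmul_scaler, qmul_scalel) !q_re_scale.
    rewrite -(qmulA m p1) pK qmul_scaler mK !(qmul_scaler, qmul_scalel).
    by rewrite !q_re_scale; field.
  by rewrite /qtri -/c; ring.
Qed.
End Quaternions.

(** * The cubic form Re(q1 q2 q3) *)

Section Dot.
Variables (R : realType) (n : nat).
Implicit Types x y : 'rV[R]_n.

Definition dotv x y : R := \sum_i x 0 i * y 0 i.

Lemma dotvC x y : dotv x y = dotv y x.
Proof. by apply: eq_bigr => i _; rewrite mulrC. Qed.

Lemma dotvDl x y z : dotv (x + y) z = dotv x z + dotv y z.
Proof. by rewrite -big_split; apply: eq_bigr => i _; rewrite mxE mulrDl. Qed.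

Lemma dotvDr x y z : dotv z (x + y) = dotv z x + dotv z y.
Proof. by rewrite !(dotvC z) dotvDl. Qed.

Lemma dotvZl a x y : dotv (a *: x) y = a * dotv x y.
Proof. by rewrite mulr_sumr; apply: eq_bigr => i _; rewrite mxE mulrA. Qed.

Lemma dotvZr a x y : dotv y (a *: x) = a * dotv y x.
Proof. by rewrite !(dotvC y) dotvZl. Qed.

Lemma dotv_ge0 x : 0 <= dotv x x.
Proof. by apply: sumr_ge0 => i _; rewrite -expr2 sqr_ge0. Qed.

Lemma dotv_eq0 x : (dotv x x == 0) = (x == 0).
Proof.
apply/eqP/eqP => [xx0|->]; last by rewrite /dotv big1// => i _;
  rewrite mxE mul0r.
apply/rowP => i; rewrite mxE; apply/eqP; rewrite -sqrf_eq0 expr2.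
move: xx0 => /eqP; rewrite psumr_eq0; last by move=> j _;
  rewrite -expr2 sqr_ge0.
by move=> /allP/(_ i); rewrite mem_index_enum => /(_ isT).
Qed.

Lemma dotv_gt0 x : (0 < dotv x x) = (x != 0).
Proof. by rewrite lt_def dotv_ge0 andbT dotv_eq0. Qed.

Lemma dotv_delta x i : dotv x (delta_mx 0 i) = x 0 i.
Proof.
rewrite /dotv (bigD1 i)//= big1 ?mxE ?eqxx ?mulr1 ?addr0// => j ji.
by rewrite mxE (negPf ji) andbF mulr0.
Qed.

Lemma enormE x : enorm x = Num.sqrt (dotv x x).
Proof. by []. Qed.

Lemma CauchySchwarz_dotv x y : dotv x y ^+ 2 <= dotv x x * dotv y y.
Proof.
have [->|y0] := eqVneq y 0.
  have -> : dotv x 0 = 0 by rewrite -(scale0r 0) dotvZr mul0r.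
  by rewrite expr0n mulr_ge0 ?dotv_ge0.
have yy : 0 < dotv y y by rewrite dotv_gt0.
have := dotv_ge0 (dotv y y *: x - dotv x y *: y).
rewrite -scaleNr !(dotvDl, dotvDr, dotvZl, dotvZr) (dotvC y x) => h.
by rewrite -subr_ge0 -(pmulr_rge0 _ yy); apply: le_trans h _;
  rewrite le_eqVlt; apply/orP; left; apply/eqP; ring.
Qed.

End Dot.

Section Cubic.
Variable R : realType.
Implicit Types x y z v : 'rV[R]_12.

Definition qvec (p1 p2 p3 : quaternion R) : 'rV[R]_12 :=
  \row_i [:: q_re p1; q_i p1; q_j p1; q_k p1; q_re p2; q_i p2; q_j p2; q_k p2;
             q_re p3; q_i p3; q_j p3; q_k p3]`_i.

Definition cub x := qtri (qblock x 0) (qblock x 1) (qblock x 2).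

(* The derivative of [cub] at x in the direction z; by trilinearity it is also
   half of the Hessian form of [cub] at z, evaluated on x. *)
Definition dcub x z :=
  qtri (qblock z 0) (qblock x 1) (qblock x 2)
  + qtri (qblock x 0) (qblock z 1) (qblock x 2)
  + qtri (qblock x 0) (qblock x 1) (qblock z 2).

Lemma qblock_qvec p1 p2 p3 : [/\ qblock (qvec p1 p2 p3) 0 = p1,
  qblock (qvec p1 p2 p3) 1 = p2 & qblock (qvec p1 p2 p3) 2 = p3].
Proof.
by case: p1 => ????; case: p2 => ????; case: p3 => ????; split;
  congr Quaternion; rewrite mxE inordK.
Qed.

Lemma dotv_qblock x y : dotv x y = qdot (qblock x 0) (qblock y 0)
  + qdot (qblock x 1) (qblock y 1) + qdot (qblock x 2) (qblock y 2).
Proof.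
rewrite /dotv /qdot/=.
have E (F : 'I_12 -> R) : \sum_i F i = \sum_(0 <= i < 12) F (inord i).
  by rewrite big_mkord; apply: eq_bigr => i _; rewrite inord_val.
by rewrite E; do 12 (rewrite big_nat_recr//=); rewrite big_nil; ring.
Qed.

Lemma cubD x v (t : R) : cub (x + t *: v) =
  cub x + t * dcub x v + t ^+ 2 * dcub v x + t ^+ 3 * cub v.
Proof. rewrite /cub /dcub /qtri/= !mxE; ring. Qed.

Lemma cubZ (a : R) x : cub (a *: x) = a ^+ 3 * cub x.
Proof. rewrite /cub /qtri/= !mxE; ring. Qed.

Lemma cub_comb x y (a b : R) : cub (a *: x + b *: y) =
  a ^+ 3 * cub x + a ^+ 2 * b * dcub x y + a * b ^+ 2 * dcub y x + b ^+ 3 *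
    cub y.
Proof. rewrite /cub /dcub /qtri/= !mxE; ring. Qed.

Lemma dcub_comb x y (a b : R) : dcub (a *: x + b *: y) x =
  3 * a ^+ 2 * cub x + 2 * a * b * dcub x y + b ^+ 2 * dcub y x.
Proof. rewrite /cub /dcub /qtri/= !mxE; ring. Qed.

Lemma dcubZl (a : R) x z : dcub (a *: x) z = a ^+ 2 * dcub x z.
Proof. rewrite /dcub /qtri/= !mxE; ring. Qed.

Lemma dcubDr x y z : dcub x (y + z) = dcub x y + dcub x z.
Proof. rewrite /dcub /qtri/= !mxE; ring. Qed.

Lemma dcubZr (a : R) x z : dcub x (a *: z) = a * dcub x z.
Proof. rewrite /dcub /qtri/= !mxE; ring. Qed.

Lemma dcubxx x : dcub x x = 3 * cub x.
Proof. rewrite /cub /dcub; ring. Qed.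
End Cubic.

(** * Frames orthogonal to two given points *)

Section Frame.
Variable R : realType.
Implicit Types x y z v p : 'rV[R]_12.

(* The right-hand side is the derivative of [cub p / dotv p p] along z. *)
Lemma exists_frame p x : p != 0 -> exists vs : seq 'rV[R]_12,
  [/\ {in vs, forall v, dotv v p = 0 /\ dotv v x = 0},
      \sum_(v <- vs) dotv v v = 1 &
      forall z, \sum_(v <- vs) dcub v z =
        dcub p z / dotv p p - 2 * cub p * dotv p z / dotv p p ^+ 2].
Proof.
move=> p0; have pp0 : dotv p p != 0 by rewrite dotv_eq0.
pose p_ := qblock p; pose x_ := qblock x; pose s := (dotv p p)^-1.
(* The quaternion frame singles out its first block. Adding its three cyclic versions restores the
   symmetry: the weights |p1|^2, |p2|^2, |p3|^2 sum to |p|^2. *)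
have [a1 [a2 [a3 [ap ax aa at_]]]] :=
  qtri_frame (p_ 0) (p_ 1) (p_ 2) (x_ 0) (x_ 1) (x_ 2).
have [b1 [b2 [b3 [bp bx bb bt]]]] :=
  qtri_frame (p_ 1) (p_ 2) (p_ 0) (x_ 1) (x_ 2) (x_ 0).
have [c1 [c2 [c3 [cp cx cc ct]]]] :=
  qtri_frame (p_ 2) (p_ 0) (p_ 1) (x_ 2) (x_ 0) (x_ 1).
(* The blocks are rotated back to their original places. Before scaling, the squared lengths add up
   to |p|^4, whence [s]. *)
exists [:: s *: qvec a1 a2 a3; s *: qvec b3 b1 b2; s *: qvec c2 c3 c1].
have [qa1 qa2 qa3] := qblock_qvec a1 a2 a3.
have [qb1 qb2 qb3] := qblock_qvec b3 b1 b2.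
have [qc1 qc2 qc3] := qblock_qvec c2 c3 c1.
split.
- move=> v; rewrite !inE => /or3P[] /eqP ->; rewrite !dotvZl !dotv_qblock.
  + by rewrite qa1 qa2 qa3 ap ax mulr0.
  + by rewrite qb1 qb2 qb3; split; rewrite -[RHS](mulr0 s);
      [rewrite -[X in _ = _ * X]bp|rewrite -[X in _ = _ * X]bx]; ring.
  + by rewrite qc1 qc2 qc3; split; rewrite -[RHS](mulr0 s);
      [rewrite -[X in _ = _ * X]cp|rewrite -[X in _ = _ * X]cx]; ring.
- rewrite !big_cons big_nil !dotvZl !dotvZr addr0.
  rewrite !(dotv_qblock (qvec _ _ _)) qa1 qa2 qa3 qb1 qb2 qb3 qc1 qc2 qc3.
  transitivity (s * s * ((qdot a1 a1 + qdot a2 a2 + qdot a3 a3)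
    + (qdot b1 b1 + qdot b2 b2 + qdot b3 b3)
    + (qdot c1 c1 + qdot c2 c2 + qdot c3 c3))); first by ring.
  rewrite aa bb cc.
  transitivity (s * s * (dotv p p * dotv p p)); last by rewrite /s; field.
  by rewrite dotv_qblock -/(p_ 0) -/(p_ 1) -/(p_ 2); ring.
- move=> z; rewrite !big_cons big_nil !dcubZl addr0 -!mulrDr /dcub.
  rewrite qa1 qa2 qa3 qb1 qb2 qb3 qc1 qc2 qc3 at_.
  rewrite [qtri _ b1 b2]qtri_cyc [qtri b3 _ b2]qtri_cyc [qtri b3 b1 _]qtri_cyc.
  rewrite -[qtri _ c3 c1]qtri_cyc -[qtri c2 _ c1]qtri_cyc -[qtri c2 c3
    _]qtri_cyc.
  set b_ := qtri (qblock z 1) b2 b3; set b' := qtri b1 _ b3;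
    set b'' := qtri b1 b2 _.
  set c_ := qtri (qblock z 2) c2 c3; set c' := qtri c1 _ c3;
    set c'' := qtri c1 c2 _.
  rewrite (_ : b'' + b_ + b' = b_ + b' + b''); last by ring.
  rewrite (_ : c' + c'' + c_ = c_ + c' + c''); last by ring.
  rewrite bt ct -/(p_ 0) -/(p_ 1) -/(p_ 2).
  rewrite -[qtri (p_ 1) (p_ 2) (p_ 0)]qtri_cyc [qtri (p_ 2) (p_ 0) (p_
    1)]qtri_cyc.
  rewrite -[qtri _ (p_ 2) (p_ 0)]qtri_cyc -[qtri (p_ 1) _ (p_ 0)]qtri_cyc
    -[qtri (p_ 1) (p_ 2) _]qtri_cyc.
  rewrite [qtri _ (p_ 0) (p_ 1)]qtri_cyc [qtri (p_ 2) _ (p_ 1)]qtri_cyc [qtri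
    (p_ 2) (p_ 0) _]qtri_cyc.
  rewrite /cub -/(p_ 0) -/(p_ 1) -/(p_ 2).
  have := pp0; rewrite /s !dotv_qblock -/(p_ 0) -/(p_ 1) -/(p_ 2) => pp.
  by field.
Qed.

(** The frame is taken at x, at y, or at a point between them, according to the signs of the
    derivatives of h = cub / dotv compared with its values. *)
Lemma exists_pair_frame x y : x != 0 -> y != 0 -> exists vs : seq 'rV[R]_12,
  [/\ {in vs, forall v, dotv v x = 0 /\ dotv v y = 0},
      \sum_(v <- vs) dotv v v = 1,
      \sum_(v <- vs) dcub v x <= cub x / dotv x x &
      cub y / dotv y y <= \sum_(v <- vs) dcub v y].
Proof.
move=> x0 y0; have Sx : 0 < dotv x x by rewrite dotv_gt0.
have Sy : 0 < dotv y y by rewrite dotv_gt0.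
pose hx := cub x / dotv x x; pose hy := cub y / dotv y y.
have cubx : cub x = hx * dotv x x by rewrite divfK ?gt_eqF.
have cuby : cub y = hy * dotv y y by rewrite divfK ?gt_eqF.
pose s := dotv x y.
(* [E / dotv x x] is dh(x)(y) - h(y), and [G / dotv y y] is dh(y)(x) - h(x). As h is homogeneous of
   degree one, dh(x)(x) = h(x); hence the frame at x works when E >= 0, and the frame at y when G <=
   0. *)
pose E := dcub x y - dotv x x * hy - 2 * s * hx.
pose G := dcub y x - dotv y y * hx - 2 * s * hy.
rewrite -/hx -/hy.
have [E0|E0] := leP 0 E.
  have [vs [vs0 vs1 vsT]] := exists_frame y x0.
  exists vs; split => //; rewrite vsT cubx -?/s.
    by rewrite dcubxx cubx le_eqVlt; apply/orP; left; apply/eqP; field;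
      rewrite gt_eqF.
  rewrite -subr_ge0 (_ : _ - _ = E / dotv x x) ?divr_ge0 ?(ltW Sx)//.
  by rewrite /E; field; rewrite gt_eqF.
have [G0|G0] := leP G 0.
  have [vs [vs0 vs1 vsT]] := exists_frame x y0.
  exists vs; split => //; first by move=> v /vs0[].
    rewrite vsT cuby dotvC -/s -subr_ge0 (_ : _ - _
      = - G / dotv y y) ?divr_ge0 ?(ltW Sy) ?oppr_ge0//.
    by rewrite /G; field; rewrite gt_eqF.
  rewrite vsT cuby dcubxx cuby le_eqVlt; apply/orP; left; apply/eqP; field;
    rewrite gt_eqF//.
(* The restriction to the segment [x, y] of cub / dotv minus its linear
   interpolation vanishes, and is nondecreasing, at the point p / (G - E). *)
have Gd : dcub y x = G + dotv y y * hx + 2 * s * hy by rewrite /G; ring.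
have Ed : dcub x y = E + dotv x x * hy + 2 * s * hx by rewrite /E; ring.
clearbody E G.
pose p := G *: x + (- E) *: y.
(* If p = 0, then x and y are collinear, and homogeneity gives dh(x)(y) = h(y), that is E = 0. *)
have p0 : p != 0.
  apply: contraTneq (E0) => p0; rewrite -leNgt.
  have xE : x = (E / G) *: y.
    have : G^-1 *: (G *: x + - E *: y) = 0 by rewrite -/p p0 scaler0.
    rewrite scalerDr !scalerA mulVf ?gt_eqF// scale1r => /eqP.
    by rewrite addr_eq0 mulrN scaleNr opprK mulrC => /eqP.
  have sE : s = E / G * dotv y y by rewrite /s xE dotvZl.
  have hxE : hx = E / G * hy.
    rewrite /hx /hy xE cubZ !(dotvZl, dotvZr); field.
    by apply/and3P; split; rewrite ?(gt_eqF G0) ?(lt_eqF E0) ?(gt_eqF Sy).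
  have : dcub x y = (E / G) ^+ 2 * (3 * (hy * dotv y y))
    by rewrite xE dcubZl dcubxx cuby.
  have Sxy : dotv x x = (E / G) ^+ 2 * dotv y y by rewrite xE dotvZl dotvZr;
    ring.
  rewrite Ed hxE sE Sxy => e0; suff -> : E = 0 by [].
  by transitivity ((E / G) ^+ 2 * (3 * (hy * dotv y y)) - (E / G) ^+ 2 * dotv
    y y * hy - 2 * (E / G * dotv y y) * (E / G * hy)); [rewrite -e0|]; ring.
have Sp : dotv p p = G ^+ 2 * dotv x x - 2 * G * E * s + E ^+ 2 * dotv y y.
  by rewrite /p !(dotvDl, dotvDr, dotvZl, dotvZr) (dotvC y x) -/s; ring.
have Sp0 : 0 < dotv p p by rewrite dotv_gt0.
have cubp : cub p = dotv p p * (G * hx - E * hy).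
  by rewrite /p cub_comb -/p Sp cubx cuby Ed Gd; ring.
have [vs [vs0 vs1 vsT]] := exists_frame x p0.
(* The gap h(x) - dh(p)(x) is exactly [G * E ^+ 2 / dotv p p]. *)
have tx : dcub p x / dotv p p - 2 * cub p * dotv p x / dotv p p ^+ 2 <= hx.
  rewrite -subr_ge0.
  rewrite (_ : _ - _ = G * E ^+ 2 / dotv p p); last first.
    rewrite cubp.
    have -> : dotv p x = G * dotv x x - E * s
      by rewrite /p dotvDl !dotvZl (dotvC y x) -/s; ring.
    have -> : dcub p x = 3 * G ^+ 2 * (hx * dotv x x) - 2 * G * E * (E + dotv
      x x * hy + 2 * s * hx) + E ^+ 2 * (G + dotv y y * hx + 2 * s * hy).
      by rewrite /p dcub_comb cubx Gd Ed; ring.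
    rewrite -[RHS](mulrK (unitf_gt0 Sp0)) -[LHS](mulrK (unitf_gt0 Sp0));
      congr (_ / _).
    have -> : G * E ^+ 2 / dotv p p * dotv p p = G * E ^+ 2
      by rewrite divfK ?gt_eqF.
    rewrite mulrBl mulrBl divfK ?gt_eqF//.
    have -> : 2 * (dotv p p * (G * hx - E * hy)) * (G * dotv x x - E * s) /
      dotv p p ^+ 2 * dotv p p = 2 * (G * hx - E * hy) * (G * dotv x x - E * s).
      by field; rewrite gt_eqF.
    by rewrite Sp; ring.
  by rewrite divr_ge0 ?(ltW Sp0)// mulr_ge0 ?sqr_ge0// ltW.
(* Since y lies in the span of p and x, both its orthogonality to the frame and its inequality
   follow from those at p and x. *)
have yE : y = (- E)^-1 *: p + (G / E) *: x.
  have E'0 : E != 0 by rewrite lt_eqF.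
  by apply/rowP => i; rewrite /p !mxE; field.
exists vs; split => //.
- move=> v /vs0[vp vx]; split => //.
  by rewrite yE dotvDr !dotvZr vp vx; ring.
- by rewrite vsT.
- rewrite [in leRHS]yE.
  under eq_bigr do rewrite dcubDr !dcubZr.
  rewrite big_split/= -!mulr_sumr !vsT dcubxx.
  set tx' := _ / _ - _ in tx *.
  (* By homogeneity dh(p)(p) = h(p), which is the interpolated value [G * hx - E * hy]. *)
  rewrite -[3 * _ / _ - _](_ : (G * hx - E * hy) = _); last by rewrite cubp;
    field; rewrite gt_eqF.
  rewrite -subr_ge0 (_ : _ - _ = (hx - tx') * (G / - E)).
    by rewrite mulr_ge0 ?subr_ge0// divr_ge0// ?oppr_ge0 ltW.
  by field; rewrite lt_eqF.
Qed.
End Frame.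

(** * Second derivatives along lines *)

Section Line.
Variable R : realType.

Lemma cvg_is_derive (V : normedModType R) (f : V -> R) (x v : V) (d : R) :
  h^-1 * (f (h *: v + x) - f x) @[h --> 0^'] --> d -> is_derive x v f d.
Proof.
by move=> fd; apply: DeriveDef; [apply/cvg_ex; exists d|exact: cvg_lim fd].
Qed.

Lemma is_derive_cvg (V : normedModType R) (f : V -> R) (x v : V) (d : R) :
  is_derive x v f d -> h^-1 * (f (h *: v + x) - f x) @[h --> 0^'] --> d.
Proof. by case=> + <-; exact. Qed.

Lemma is_derive_line (V : normedModType R) (f : V -> R) (x v : V) (t d : R) :
  is_derive (t *: v + x) v f d -> is_derive t (1 : R) (fun s => f (s *: v +
    x)) d.
Proof.
move=> /is_derive_cvg fd; apply: cvg_is_derive.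
rewrite (_ : (fun h => _) = (fun h => h^-1 * (f (h *: v + (t *: v + x)) - f (t
  *: v + x))))//.
by apply/funext => h; rewrite addrA -scalerDl [h%:A]mulr1.
Qed.

(** Absolute values allow steps of either sign; for negative r the mean value theorem is applied on
    [r, 0]. *)
Lemma MVT_line (V : normedModType R) (f : V -> R) (x v : V) (r : R) :
  (forall s : R, `|s| <= `|r| -> derivable f (s *: v + x) v) ->
  exists2 s, `|s| <= `|r| & f (r *: v + x) - f x = r * 'D_v f (s *: v + x).
Proof.
move=> fv; pose g s := f (s *: v + x); pose g1 s := 'D_v f (s *: v + x).
have dg (s : R) : `|s| <= `|r| -> is_derive s (1 : R) g (g1 s).
  by move=> /fv fs; apply: is_derive_line; exact: derivableP.
have g0 : g 0 = f x by rewrite /g scale0r add0r.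
rewrite -g0 -/(g r).
have [r0|r0] := leP 0 r.
  have inr (s : R) : s \in `[0, r] -> `|s| <= `|r|.
    by rewrite in_itv/= => /andP[s0 sr]; rewrite !ger0_norm.
  have [||s /inr sr ->] := @MVT_segment _ g g1 0 r r0.
  - by move=> s sr; apply/dg/inr; exact: subset_itv_oo_cc sr.
  - by apply: derivable_within_continuous => s /inr /dg[].
  by exists s => //; rewrite subr0 mulrC.
have inr (s : R) : s \in `[r, 0] -> `|s| <= `|r|.
  by rewrite in_itv/= => /andP[s0 sr]; rewrite !ler0_norm ?(ltW r0)// lerN2.
have [||s /inr sr gr] := @MVT_segment _ g g1 r 0 (ltW r0).
- by move=> s sr; apply/dg/inr; exact: subset_itv_oo_cc sr.
- by apply: derivable_within_continuous => s /inr /dg[].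
by exists s => //; rewrite -opprB gr sub0r mulrN opprK mulrC.
Qed.

(** The derivative [g1] vanishes at the minimum. If d < 0, it is negative just to the right of 0,
    and the mean value theorem makes g smaller there than at 0. *)
Lemma second_derivative_min (g g1 : R -> R) (d : R) :
  (\forall t \near (0 : R), is_derive t (1 : R) g (g1 t)) -> is_derive (0 : R)
    (1 : R) g1 d ->
  (\forall t \near (0 : R), g 0 <= g t) -> 0 <= d.
Proof.
move=> dg dg1 gmin; rewrite leNgt; apply/negP => d0.
have : \forall t \near (0 : R), is_derive t (1 : R) g (g1 t) /\ g 0 <= g t.
  exact: filterI.
move=> /nbhs_normP[e /= e0 He].
have H (t : R) : `|t| < e -> is_derive t (1 : R) g (g1 t) /\ g 0 <= g t.
  by move=> te; apply: He; rewrite /= sub0r normrN.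
have g10 : g1 0 = 0.
  have itvE (t : R) : t \in `](- e), e[ -> `|t| < e
    by rewrite in_itv/= ltr_norml.
  have D0 : is_derive (0 : R) (1 : R) g 0.
    apply: (@derive1_at_min R g (- e) e 0).
    - by rewrite -subr_ge0 opprK addr_ge0// ltW.
    - by move=> t /itvE /H[[]].
    - by rewrite in_itv/= oppr_lt0 e0.
    - by move=> t /itvE /H[].
  have [|[_ <-] _] := H 0; first by rewrite normr0.
  by case: D0.
have /cvgr_lt/(_ _ d0) := is_derive_cvg dg1.
rewrite near_withinE => /nbhs_normP[e' /= e'0 He'].
pose r := Num.min e e' / 2.
have r0 : 0 < r by rewrite divr_gt0// lt_min e0.
have [re re'] : r < e /\ r < e'.
  split; rewrite ltr_pdivrMr// mulr_natr mulr2n.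
    by rewrite (@le_lt_trans _ _ e) ?ge_min ?lexx// ltrDl.
  by rewrite (@le_lt_trans _ _ e') ?ge_min ?lexx ?orbT// ltrDl.
have [t||t] := @MVT _ g g1 0 r r0.
- rewrite in_itv/= => /andP[t0 tr].
  by case: (H t) => //; rewrite gtr0_norm// (lt_trans tr).
- apply: derivable_within_continuous => t; rewrite in_itv/= => /andP[t0 tr].
  by case: (H t) => [|[]//]; rewrite ger0_norm// (le_lt_trans tr).
rewrite in_itv/= => /andP[t0 tr] gr.
have g1t : 0 <= g1 t.
  have : g 0 <= g r by case: (H r) => //; rewrite gtr0_norm.
  by rewrite -subr_ge0 gr subr0 pmulr_lge0.
suff : g1 t < 0 by rewrite ltNge g1t.
have := He' t; rewrite /= sub0r normrN gtr0_norm// (lt_trans tr)// gt_eqF//.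
move=> /(_ isT isT); rewrite addr0 [_%:A]mulr1 g10 subr0.
by rewrite pmulr_rlt0// invr_gt0.
Qed.

End Line.

Section Directional.
Variables (R : realType) (n : nat).
Implicit Types (f : 'rV[R]_n.+1 -> R) (x v : 'rV[R]_n.+1).

(** The base point [h *: a + x] moves with h, so existence of the partial derivative at x is not
    enough: the mean value theorem is combined with its continuity at x. *)
Lemma partial_quotient f x a i (c : R) :
  (\forall y \near x, derivable f y (delta_mx 0 i)) ->
  {for x, continuous (partial i f)} ->
  h^-1 * (f (h *: (c *: delta_mx 0 i + a) + x) - f (h *: a + x))
    @[h --> 0^'] --> c * partial i f x.
Proof.
move=> df cf; apply/cvgrPdist_le => /= eps eps0.
(* Adding 1 keeps the divisor positive when c = 0. *)
have c0 : 0 < `|c| + 1 by rewrite ltr_wpDl.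
have ec0 : 0 < eps / (`|c| + 1) by rewrite divr_gt0.
move/cvgrPdist_le/(_ _ ec0) : cf => cf.
have : \forall y \near x, derivable f y (delta_mx 0 i) /\
    `|partial i f x - partial i f y| <= eps / (`|c| + 1).
  exact: filterI.
move=> /nbhs_normP[d /= d0 H].
pose e : 'rV[R]_n.+1 := delta_mx 0 i.
near=> h.
have h0 : h != 0 by near: h; exact: nbhs_dnbhs_neq.
have hsmall : `|h| * (`|c| * `|e| + `|a| + 1) < d.
  rewrite -ltr_pdivlMr ?ltr_wpDl ?addr_ge0 ?mulr_ge0//.
  near: h; apply: dnbhs0_lt; rewrite divr_gt0 ?ltr_wpDl ?addr_ge0 ?mulr_ge0//.
have inb s : `|s| <= `|h * c| -> `|x - (s *: e + (h *: a + x))| < d.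
  move=> sh; apply: le_lt_trans hsmall;
  rewrite distrC addrA addrK (le_trans (ler_normD _ _))// !normrZ.
  rewrite normrM in sh.
  rewrite !mulrDr mulr1 -[leLHS]addr0 lerD// lerD2r mulrA.
  by rewrite ler_wpM2r.
have [|s sh E] := @MVT_line R _ f (h *: a + x) e (h * c).
  by move=> s /inb /H[].
have [_ /= Ds] := H _ (inb _ sh).
rewrite scalerDr scalerA -addrA E -[h * c * _]mulrA mulKf// -mulrBr normrM.
by rewrite (le_trans (ler_wpM2l _ Ds))// mulrCA ler_piMr ?(ltW eps0)//
  ler_pdivrMr// mul1r lerDl.

Unshelve. all: by end_near. Qed.

(** The displacement is built up one coordinate at a time, each increment contributing one term of
    the sum. *)
Lemma C1_is_derive f x v : (\forall y \near x, forall i, derivable f y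
  (delta_mx 0 i)) ->
  (forall i, {for x, continuous (partial i f)}) ->
  is_derive x v f (\sum_i v 0 i * partial i f x).
Proof.
move=> df cf; rewrite [X in is_derive _ X]row_sum_delta.
elim: (index_enum _) => [|i s IH]; first by rewrite !big_nil; exact: is_derive0.
rewrite !big_cons; apply: cvg_is_derive.
set a := \sum_(j <- s) _ in IH *.
rewrite (_ : (fun h => _) = (fun h : R => h^-1 *
  (f (h *: (v 0 i *: delta_mx 0 i + a) + x) - f (h *: a + x)) +
  h^-1 * (f (h *: a + x) - f x))); last first.
  by apply/funext => h; rewrite -mulrDr addrA subrK.
apply: cvgD; last exact: is_derive_cvg.
apply: partial_quotient (cf i).
by apply: filterS df => y; exact.
Qed.
End Directional.

Section C2.
Variables (R : realType) (n : nat).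
Implicit Types (f : 'rV[R]_n.+1 -> R) (x v : 'rV[R]_n.+1).

Definition qform (M : 'M[R]_n.+1) v : R := (v *m M *m v^T) 0 0.

Lemma qformN (M : 'M[R]_n.+1) v : qform M (- v) = qform M v.
Proof. by rewrite /qform linearN/= mulmxN !mulNmx opprK. Qed.

Lemma near_line x v (P : set 'rV[R]_n.+1) :
  nbhs x P -> \forall t \near (0 : R), P (t *: v + x).
Proof.
move=> Px; have : (fun t : R => t *: v + x) @ (0 : R) --> 0 *: v + x.
  by apply: cvgD; [apply: cvgZr_tmp; exact: cvg_id|exact: cvg_cst].
by rewrite scale0r add0r; apply.
Qed.

(** This reduces every use of the Hessian to second derivatives of functions of one real
    variable. *)
Lemma C2_line f x v : C2_near f x ->
  let g1 (t : R) := \sum_i v 0 i * partial i f (t *: v + x) in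
  (\forall t \near (0 : R), is_derive t (1 : R) (fun s => f (s *: v + x)) (g1
    t)) /\
  is_derive (0 : R) (1 : R) g1 (qform (hessian f x) v).
Proof.
move=> fx g1; split.
  have /near_line : nbhs x (fun y => is_derive y v f (\sum_i v 0 i * partial i
    f y)).
    (* At each nearby y the regularity is required in a whole neighbourhood of y, hence the passage
       to the interior. *)
    move/nbhs_interior : fx; apply: filterS => y fy.
    apply: C1_is_derive.
      by apply: filterS fy => z [_ fz _] i; case: (fz i).
    by move=> i; have [_ /(_ i)[]] := nbhs_singleton fy.
  by move=> /(_ v); apply: filterS => t; exact: is_derive_line.
have dfi i : is_derive (0 : R) (1 : R) (fun t => partial i f (t *: v + x))
    (\sum_j v 0 j * hessian f x j i).
  apply: is_derive_line; rewrite scale0r add0r.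
  rewrite (eq_bigr (fun j => v 0 j * partial j (partial i f) x)); last first.
    by move=> j _; rewrite mxE.
  apply: C1_is_derive.
    by apply: filterS fx => z [_ _ fz] j; case: (fz j i).
  by move=> j; have [_ _ /(_ j i)[]] := nbhs_singleton fx.
rewrite (_ : g1 = \sum_i (v 0 i \*: (fun t => partial i f (t *: v + x))));
  last first.
  by apply/funext => t; rewrite fct_sumE.
apply: is_derive_eq.
rewrite /qform mxE; apply: eq_bigr => i _.
by rewrite !mxE mulrC.
Qed.

End C2.

(** * Polynomials times real powers of polynomials *)

Section PolyPowR.
Variable R : realType.
Implicit Types (p q : {poly R}) (a t : R).

Lemma is_derive_poly_powR p q a t : 0 < q.[t] ->
  is_derive t (1 : R) (fun s => p.[s] * q.[s] `^ a)
    (p^`().[t] * q.[t] `^ a + a * (p * q^`()).[t] * q.[t] `^ (a - 1)).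
Proof.
move=> qt; have := @is_derive1_powR R a _ qt => dpow.
have dqa : is_derive t (1 : R) ((@powR R ^~ a) \o horner q) (a * q.[t] `^ (a -
  1) * q^`().[t]).
  exact: is_derive1_comp.
rewrite (_ : (fun s => _) = horner p * ((@powR R ^~ a) \o horner q))//.
apply: is_derive_eq; rewrite /= hornerM.
rewrite /GRing.scale/=; ring.
Qed.

(** On a line, [w_delta] is a cubic polynomial times a power of a quadratic one. The first
    derivative is a sum of two products of the same shape, so the first-order formula applies
    again. *)
Lemma second_derivative_poly_powR p q a : 0 < q.[0] ->
  let g1 t := p^`().[t] * q.[t] `^ a + a * (p * q^`()).[t] * q.[t] `^ (a - 1) in
  (\forall t \near (0 : R), is_derive t (1 : R) (fun s => p.[s] * q.[s] `^ a)
    (g1 t)) /\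
  is_derive (0 : R) (1 : R) g1 (q.[0] `^ a * (p^`()^`().[0]
     + 2 * a * p^`().[0] * q^`().[0] / q.[0] + a * p.[0] * q^`()^`().[0] / q.[0]
     + a * (a - 1) * p.[0] * q^`().[0] ^+ 2 / q.[0] ^+ 2)).
Proof.
move=> q0 g1; split.
  have : \forall t \near (0 : R), 0 < q.[t].
    by have /cvgr_gt/(_ _ q0) := @continuous_horner R q 0.
  by apply: filterS => t; exact: is_derive_poly_powR.
rewrite (_ : g1 = (fun s => p^`().[s] * q.[s] `^ a) + (fun s => (a *: (p *
  q^`())).[s] * q.[s] `^ (a - 1))); last first.
  by apply/funext => t; rewrite /g1 fctE hornerZ.
have := is_derive_poly_powR p^`() a q0.
have := is_derive_poly_powR (a *: (p * q^`())) (a - 1) q0 => d1 d2.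
apply: is_derive_eq.
have aS b : q.[0] `^ (b - 1) = q.[0] `^ b / q.[0].
  by rewrite powRB ?powRr1 ?(ltW q0)// (gt_eqF q0) implybT.
rewrite !aS derivZ derivM !(hornerZ, hornerM, hornerD).
by field; rewrite gt_eqF.
Qed.
End PolyPowR.

(** * Continuity of the cubic form and of the squared norm *)

Section Continuity.
Variable R : realType.

Definition qcontinuous (T : topologicalType) (q : T -> quaternion R) :=
  [/\ continuous (fun x => q_re (q x)), continuous (fun x => q_i (q x)),
      continuous (fun x => q_j (q x)) & continuous (fun x => q_k (q x))].

Lemma qcontinuous_mul (T : topologicalType) (p q : T -> quaternion R) :
  qcontinuous p -> qcontinuous q -> qcontinuous (fun x => qmul (p x) (q x)).
Proof.
have cM (f g : T -> R) : continuous f -> continuous g -> continuous (fun x =>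
  f x * g x).
  by move=> cf cg x; apply: cvgM; [exact: cf|exact: cg].
have cD (f g : T -> R) : continuous f -> continuous g -> continuous (fun x =>
  f x + g x).
  by move=> cf cg x; apply: cvgD; [exact: cf|exact: cg].
have cB (f g : T -> R) : continuous f -> continuous g -> continuous (fun x =>
  f x - g x).
  by move=> cf cg x; apply: cvgB; [exact: cf|exact: cg].
have qmulE (a b : quaternion R) : qmul a b = Quaternion
    (q_re a * q_re b - q_i a * q_i b - q_j a * q_j b - q_k a * q_k b)
    (q_re a * q_i b + q_i a * q_re b + q_j a * q_k b - q_k a * q_j b)
    (q_re a * q_j b - q_i a * q_k b + q_j a * q_re b + q_k a * q_i b)
    (q_re a * q_k b + q_i a * q_j b - q_j a * q_i b + q_k a * q_re b).
  by case: a => ????; case: b.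
move=> [p0 p1 p2 p3] [q0 q1 q2 q3].
under [fun x => qmul _ _]funext do rewrite qmulE.
split => /=.
- exact (cB _ _ (cB _ _ (cB _ _ (cM _ _ p0 q0) (cM _ _ p1 q1)) (cM _ _ p2 q2))
    (cM _ _ p3 q3)).
- exact (cB _ _ (cD _ _ (cD _ _ (cM _ _ p0 q1) (cM _ _ p1 q0)) (cM _ _ p2 q3))
    (cM _ _ p3 q2)).
- exact (cD _ _ (cD _ _ (cB _ _ (cM _ _ p0 q2) (cM _ _ p1 q3)) (cM _ _ p2 q0))
    (cM _ _ p3 q1)).
- exact (cD _ _ (cB _ _ (cD _ _ (cM _ _ p0 q3) (cM _ _ p1 q2)) (cM _ _ p2 q1))
    (cM _ _ p3 q0)).
Qed.

Lemma qcontinuous_qblock k : qcontinuous (fun x : 'rV[R]_12 => qblock x k).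
Proof. by split=> x; exact: coord_continuous. Qed.

Lemma continuous_cub : continuous (@cub R).
Proof.
have [c _ _ _] := qcontinuous_mul
  (qcontinuous_mul (qcontinuous_qblock 0) (qcontinuous_qblock 1))
    (qcontinuous_qblock 2).
exact: c.
Qed.

Lemma continuous_dotv n : continuous (fun x : 'rV[R]_n.+1 => dotv x x).
Proof.
move=> x; rewrite /dotv; elim: (index_enum _) => [|i s IH].
  rewrite /continuous_at big_nil (_ : (fun y => _) = cst 0); last first.
    by apply/funext => y; rewrite big_nil.
  exact: (@cst_continuous _ _ (0 : R)).
rewrite /continuous_at big_cons.
rewrite (_ : (fun y => _) = (fun y : 'rV[R]_n.+1 => y 0 i * y 0 i + \sum_(j <-
  s) y 0 j * y 0 j)); last first.
  by apply/funext => y; rewrite big_cons.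
by apply: cvgD IH; apply: cvgM; exact: coord_continuous.
Qed.
End Continuity.

(** * Contact with test functions *)

Lemma second_derivative_le (R : realType) (f f1 g g1 : R -> R) (df dg : R) :
  (\forall t \near (0 : R), is_derive t (1 : R) f (f1 t)) ->
  is_derive (0 : R) (1 : R) f1 df ->
  (\forall t \near (0 : R), is_derive t (1 : R) g (g1 t)) ->
  is_derive (0 : R) (1 : R) g1 dg ->
  (\forall t \near (0 : R), f 0 - g 0 <= f t - g t) -> dg <= df.
Proof.
move=> hf hf1 hg hg1 fg; rewrite -subr_ge0.
apply: (@second_derivative_min R (f - g) (f1 - g1)) fg => //.
by apply: filterS2 hf hg => t ? ?; exact: is_deriveB.
Qed.

Section Solution.
Variables (R : realType) (delta : R).
Implicit Types (x v y : 'rV[R]_12).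
Let m := 1 + delta.

(** The formula also covers the origin because the cubic form vanishes there. *)
Lemma w_deltaE x : w_delta delta x = cub x * dotv x x `^ (- (m / 2)).
Proof.
rewrite /w_delta /w; have [->|x0] := eqVneq x 0.
  by rewrite [cub 0](_ : _ = 0) ?mul0r//
    -(scale0r (0 : 'rV[R]_12)) cubZ expr0n mul0r.
have S0 : 0 < dotv x x by rewrite dotv_gt0.
rewrite enormE -powR12_sqrt ?ltW// -powRrM -mulrA -invfM.
rewrite -powRD ?(gt_eqF S0) ?implybT// powRN.
by congr (_ / _ `^ _); rewrite /m; field.
Qed.

Lemma w_deltaN x : w_delta delta (- x) = - w_delta delta x.
Proof.
by rewrite !w_deltaE -scaleN1r cubZ dotvZl dotvZr !mulN1r opprK; ring.
Qed.

(* The Hessian form of [w_delta delta] at x, divided by |x|^(-m). *)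
Definition hform x v := 2 * dcub v x - 2 * m * dcub x v * dotv x v / dotv x x
  - m * cub x * dotv v v / dotv x x
  + m * (m + 2) * cub x * dotv x v ^+ 2 / dotv x x ^+ 2.

Lemma w_delta_line x v : x != 0 -> exists g1 : R -> R,
  (\forall t \near (0 : R),
     is_derive t (1 : R) (fun s => w_delta delta (s *: v + x)) (g1 t)) /\
  is_derive (0 : R) (1 : R) g1 (dotv x x `^ (- (m / 2)) * hform x v).
Proof.
move=> x0; have S0 : 0 < dotv x x by rewrite dotv_gt0.
(* [p] and [q] are the cubic form and the squared norm restricted to the line s v + x. *)
pose p : {poly R} := (cub x)%:P + dcub x v *: 'X + dcub v x *: 'X^2 + cub v *:
  'X^3.
pose q : {poly R} := (dotv x x)%:P + (2 * dotv x v) *: 'X + dotv v v *: 'X^2.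
have hE := (hornerD, hornerZ, hornerC, hornerX, hornerXn, hornerMn).
have dE := (derivD, derivZ, derivC, derivX, derivXn, derivMn, raddf0).
have uE : (fun s => w_delta delta (s *: v + x))
  = (fun s => p.[s] * q.[s] `^ (- (m / 2))).
  apply/funext => s; rewrite w_deltaE addrC cubD.
  rewrite !(dotvDl, dotvDr, dotvZl, dotvZr) (dotvC v x) /p /q !hE.
  by congr (_ * _ `^ _); ring.
have q0 : 0 < q.[0] by rewrite /q !hE expr0n/= !mulr0 !addr0.
rewrite uE; have [d1 d2] := second_derivative_poly_powR p (- (m / 2)) q0.
exists (fun t => p^`().[t] * q.[t] `^ (- (m / 2)) + (- (m / 2)) * (p *
  q^`()).[t] * q.[t] `^ (- (m / 2) - 1)).
split => //; apply: is_derive_eq.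
have -> : q.[0] = dotv x x by rewrite /q !hE; ring.
congr (_ * _).
have -> : p.[0] = cub x by rewrite /p !hE; ring.
have -> : p^`().[0] = dcub x v by rewrite /p !dE !hE; ring.
have -> : p^`()^`().[0] = 2 * dcub v x by rewrite /p !dE !hE; ring.
have -> : q^`().[0] = 2 * dotv x v by rewrite /q !dE !hE; ring.
have -> : q^`()^`().[0] = 2 * dotv v v by rewrite /q !dE !hE; ring.
by rewrite /hform; field; rewrite gt_eqF.
Qed.

(** Along every line through x, the test function minus the solution has a local minimum at x. *)
Lemma touching_above x (phi : 'rV[R]_12 -> R) : x != 0 -> C2_near phi x ->
  local_max (fun y => w_delta delta y - phi y) x ->
  forall v, dotv x x `^ (- (m / 2)) * hform x v <= qform (hessian phi x) v.
Proof.
move=> x0 /C2_line phi2 xmax v; have [d1 d2] := phi2 v.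
have [g1 [e1 e2]] := w_delta_line v x0.
apply: (second_derivative_le d1 d2 e1 e2).
move/near_line : xmax => /(_ v); apply: filterS => t.
  rewrite scale0r add0r => h.
by rewrite -[leLHS]opprB -[leRHS]opprB lerN2.
Qed.

Lemma touching_below x (phi : 'rV[R]_12 -> R) : x != 0 -> C2_near phi x ->
  local_min (fun y => w_delta delta y - phi y) x ->
  forall v, qform (hessian phi x) v <= dotv x x `^ (- (m / 2)) * hform x v.
Proof.
move=> x0 /C2_line phi2 xmin v; have [d1 d2] := phi2 v.
have [g1 [e1 e2]] := w_delta_line v x0.
apply: (second_derivative_le e1 e2 d1 d2).
by move/near_line : xmin => /(_ v); apply: filterS => t; rewrite scale0r add0r.
Qed.

(* At the origin only the oddness of the solution matters: a test function
   touching it from above satisfies phi(y) + phi(-y) >= 2 phi(0). *)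
Lemma touching_above0 (phi : 'rV[R]_12 -> R) : C2_near phi 0 ->
  local_max (fun y => w_delta delta y - phi y) 0 ->
  forall v, 0 <= qform (hessian phi 0) v.
Proof.
move=> /C2_line phi2 xmax v; have [d1 d2] := phi2 v; have [e1 e2] := phi2 (- v).
have u0 : w_delta delta 0 = 0 by rewrite /w_delta eqxx.
(* The two sides are the second derivatives at t = 0 of - phi(- t v) and phi(t v). *)
suff : - qform (hessian phi 0) (- v) <= qform (hessian phi 0) v.
  by rewrite qformN; lra.
apply: (second_derivative_le d1 d2 (filterS _ e1) (is_deriveN e2)).
  by move=> t; exact: is_deriveN.
have := near_line v xmax; have := near_line (- v) xmax; apply: filterS2 => t.
  rewrite !fctE !scale0r !addr0 u0 sub0r scalerN w_deltaN.
  move: (w_delta _ _) (phi _) (phi _) (phi _) => a b c d.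
  lra.
Qed.

Lemma touching_below0 (phi : 'rV[R]_12 -> R) : C2_near phi 0 ->
  local_min (fun y => w_delta delta y - phi y) 0 ->
  forall v, qform (hessian phi 0) v <= 0.
Proof.
move=> /C2_line phi2 xmin v; have [d1 d2] := phi2 v; have [e1 e2] := phi2 (- v).
have u0 : w_delta delta 0 = 0 by rewrite /w_delta eqxx.
suff : qform (hessian phi 0) v <= - qform (hessian phi 0) (- v).
  by rewrite qformN; lra.
apply: (second_derivative_le (filterS _ e1) (is_deriveN e2) d1 d2).
  by move=> t; exact: is_deriveN.
have := near_line v xmin; have := near_line (- v) xmin; apply: filterS2 => t.
  rewrite !fctE !scale0r !addr0 u0 sub0r scalerN w_deltaN.
  move: (w_delta _ _) (phi _) (phi _) (phi _) => a b c d.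
  lra.
Qed.

(** The real part is at most the modulus, moduli of quaternions multiply, and each block is no
    longer than x. *)
Lemma cub_sqr_le x : cub x ^+ 2 <= dotv x x ^+ 3.
Proof.
have q_ge0 (p : quaternion R) : 0 <= qdot p p
  by rewrite /qdot -!expr2 !addr_ge0 ?sqr_ge0.
pose c := qmul (qmul (qblock x 0) (qblock x 1)) (qblock x 2).
apply: (@le_trans _ _ (qdot c c)).
  by rewrite /cub /qtri -/c /qdot -!expr2 -!addrA lerDl !addr_ge0 ?sqr_ge0.
rewrite /c !qdot_mul dotv_qblock.
move: (qdot (qblock x 0) _) (q_ge0 (qblock x 0)) => a a0.
move: (qdot (qblock x 1) _) (q_ge0 (qblock x 1)) => b b0.
move: (qdot (qblock x 2) _) (q_ge0 (qblock x 2)) => d d0.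
by rewrite !exprS expr0 mulr1 mulrA ler_pM ?mulr_ge0 ?ler_pM//; lra.
Qed.

Lemma continuous_w_delta : 0 <= delta < 1 -> continuous (w_delta delta).
Proof.
move=> /andP[delta0 delta1] x; have [->|x0] := eqVneq x 0; last first.
  rewrite (_ : w_delta delta = fun x => cub x * dotv x x `^ (- (m / 2)));
    last first.
    by apply/funext => y; exact: w_deltaE.
  have S0 : 0 < dotv x x by rewrite dotv_gt0.
  have cpow : {for dotv x x, continuous (@powR R ^~ (- (m / 2)))}.
    apply/differentiable_continuous/derivable1_diffP.
    by have [] := @is_derive1_powR R (- (m / 2)) _ S0.
  exact: (cvgM (@continuous_cub R x) (continuous_comp (@continuous_dotv R 11
    x) cpow)).
suff : w_delta delta y @[y --> (0 : 'rV[R]_12)] --> w_delta delta 0 by [].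
apply/(cvgrPdist_lt (FF := nbhs_filter (0 : 'rV[R]_12))) => e e0.
have S_cvg0 : dotv y y @[y --> (0 : 'rV[R]_12)] --> (0 : R).
  by rewrite -[X in _ --> X](_ : dotv (0 : 'rV[R]_12) 0 = 0);
    [exact: continuous_dotv|apply/eqP; rewrite dotv_eq0].
(* With S = |y|^2 <= 1 and m / 2 <= 1, the power S^(-m/2) is at most 1 / S, so the square of the
   function is at most S^3 / S^2 = S. *)
have e20 : 0 < Num.min 1 (e ^+ 2) by rewrite lt_min ltr01 exprn_gt0.
have := cvgr_lt (FF := nbhs_filter (0 : 'rV[R]_12)) _ S_cvg0 _ e20.
apply: (@filterS _ _ (nbhs_filter (0 : 'rV[R]_12))) => y;
  rewrite lt_min => /andP[y1 ye].
rewrite {1}/w_delta eqxx sub0r normrN.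
have [->|y0] := eqVneq y 0; first by rewrite /w_delta eqxx normr0.
have S0 : 0 < dotv y y by rewrite dotv_gt0.
rewrite -(@ltr_pXn2r _ 2)// ?nnegrE ?(ltW e0)// real_normK ?num_real//.
apply: le_lt_trans ye; rewrite w_deltaE exprMn.
have pw : dotv y y `^ (- (m / 2)) <= (dotv y y)^-1.
  rewrite -[leRHS]powR_inv1 ?(ltW S0)//; apply: ger_powR;
    first by rewrite S0 ltW.
  by rewrite lerN2 /m ler_pdivrMr// mul1r; lra.
apply: (@le_trans _ _ (dotv y y ^+ 3 * (dotv y y)^-1 ^+ 2)).
  by rewrite ler_pM ?sqr_ge0 ?cub_sqr_le// ler_pXn2r//
    nnegrE ?powR_ge0 ?invr_ge0 ?(ltW S0).
by rewrite le_eqVlt; apply/orP; left; apply/eqP; field; rewrite gt_eqF.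
Qed.

End Solution.

(** * Isaacs operators *)

Section Coefficients.
Variables (R : realType) (n : nat).
Implicit Types (x v : 'rV[R]_n.+1) (M : 'M[R]_n.+1) (vs : seq 'rV[R]_n.+1).

(** For row vectors [v^T *m v] is the outer product, so the sum is positive semidefinite with trace
    the sum of the [dotv v v]. *)
Definition coef_mx (eps : R) vs : 'M[R]_n.+1 :=
  eps%:M + \sum_(v <- vs) v^T *m v.

Lemma coef_mx_sym eps vs : (coef_mx eps vs)^T = coef_mx eps vs.
Proof.
rewrite linearD/= tr_scalar_mx raddf_sum/=; congr (_ + _).
by apply: eq_bigr => v _; rewrite trmx_mul trmxK.
Qed.

Lemma mulmx_tr_dotv x v : (x *m v^T) 0 0 = dotv x v.
Proof. by rewrite mxE; apply: eq_bigr => i _; rewrite mxE. Qed.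

Lemma qform_coef_mx eps vs x :
  qform (coef_mx eps vs) x = eps * dotv x x + \sum_(v <- vs) dotv v x ^+ 2.
Proof.
rewrite /qform /coef_mx mulmxDr mulmxDl mxE mul_mx_scalar -scalemxAl mxE
  mulmx_tr_dotv.
congr (_ + _); rewrite mulmx_sumr mulmx_suml summxE; apply: eq_bigr => v _.
by rewrite mulmxA -mulmxA mxE big_ord1 !mulmx_tr_dotv (dotvC x) expr2.
Qed.

(** The trace involves M only through values of its quadratic form, which are the quantities
    controlled by restriction to lines. *)
Lemma mxtrace_coef_mx eps vs M : \tr (coef_mx eps vs *m M) =
  eps * (\sum_i qform M (delta_mx 0 i)) + \sum_(v <- vs) qform M v.
Proof.
rewrite /coef_mx mulmxDl mxtraceD mul_scalar_mx mxtraceZ; congr (_ * _ + _).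
  apply: eq_bigr => i _; rewrite /qform -rowE mxE (bigD1 i)//= big1 ?addr0.
    by rewrite !mxE !eqxx mulr1.
  by move=> j ji; rewrite !mxE (negPf ji) andbF mulr0.
rewrite mulmx_suml raddf_sum/=; apply: eq_bigr => v _.
by rewrite -mulmxA mxtrace_mulC trace_mx11.
Qed.

(** A crude bound from 2 |a b| <= a^2 + b^2; it bounds the traces uniformly over the family. *)
Lemma qform_bound M v : `|qform M v| <= (\sum_i \sum_j `|M i j|) * dotv v v.
Proof.
rewrite /qform mxE.
have sq i : v 0 i ^+ 2 <= dotv v v.
  by rewrite /dotv (bigD1 i)//= expr2 lerDl sumr_ge0// => j _;
    rewrite -expr2 sqr_ge0.
have -> : \sum_j (v *m M) 0 j * v^T j 0 = \sum_i \sum_j M i j * (v 0 i * v 0 j).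
  rewrite exchange_big/=; apply: eq_bigr => j _.
  by rewrite mxE mulr_suml; apply: eq_bigr => i _; rewrite mxE; ring.
apply: (le_trans (ler_norm_sum _ _ _)); rewrite mulr_suml;
  apply: ler_sum => i _.
apply: (le_trans (ler_norm_sum _ _ _)); rewrite mulr_suml;
  apply: ler_sum => j _.
rewrite normrM ler_wpM2l// ler_norml.
have := sq i; have := sq j.
have := sqr_ge0 (v 0 i - v 0 j); have := sqr_ge0 (v 0 i + v 0 j).
move: (v 0 i) (v 0 j) (dotv v v) => a b c; nra.
Qed.

(** By Cauchy-Schwarz the form lies between eps |xi|^2 and (1 + eps) |xi|^2; the constant dominates
    both 1 / eps and 1 + eps. *)
Lemma uniformly_elliptic_coef_mx (IA IB : Type) (eps : R)
    (vs : IA -> IB -> seq 'rV[R]_n.+1) : 0 < eps ->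
  (forall a b, \sum_(v <- vs a b) dotv v v = 1) ->
  uniformly_elliptic (fun a b => coef_mx eps (vs a b)) (eps^-1 + 1 + eps).
Proof.
move=> eps0 vs1 a b; split; first exact: coef_mx_sym.
move=> xi; rewrite -/(qform _ _) qform_coef_mx enormE sqr_sqrtr ?dotv_ge0//.
have ie0 : 0 < eps^-1 by rewrite invr_gt0.
have xi0 := dotv_ge0 xi.
have s0 : 0 <= \sum_(v <- vs a b) dotv v xi ^+ 2 by apply: sumr_ge0 => v _;
  exact: sqr_ge0.
have s1 : \sum_(v <- vs a b) dotv v xi ^+ 2 <= dotv xi xi.
  rewrite -[leRHS]mul1r -(vs1 a b) mulr_suml; apply: ler_sum => v _.
  exact: CauchySchwarz_dotv.
apply/andP; split.
  rewrite -[leLHS]addr0 lerD// ler_wpM2r// -[leRHS]invrK lef_pV2 ?posrE//.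
    by rewrite -addrA lerDl addr_ge0// ltW.
  by rewrite !addr_gt0.
rewrite (mulrDl _ eps) addrC lerD2r; apply: (le_trans s1).
by rewrite -[leLHS]mul1r ler_wpM2r// lerDr ltW.
Qed.

End Coefficients.

Section Isaacs.
Variables (R : realType) (n : nat) (IA IB : Type) (A : IA -> IB -> 'M[R]_n).
Variables (M : 'M[R]_n) (K : R).
Hypothesis bounded : forall a b, `|\tr (A a b *m M)| <= K.

Let g b := inf [set \tr (A a b *m M) | a in [set: IA]].

Let has_lb b : has_lbound [set \tr (A a b *m M) | a in [set: IA]].
Proof.
by exists (- K) => _ [a _ <-]; have := bounded a b;
  rewrite ler_norml => /andP[].
Qed.

(** The supremum is at least the infimum at this one b. Boundedness makes the infima bounded above,
    by comparison with a fixed index [a0]. *)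
Lemma isaacs_operator_ge0 b : inhabited IA ->
  (forall a, 0 <= \tr (A a b *m M)) -> 0 <= isaacs_operator A M.
Proof.
move=> [a0] Ab; apply: (@le_trans _ _ (g b)).
  by apply: lb_le_inf; [exists (\tr (A a0 b *m M)), a0|move=> _ [a _ <-]].
apply: ub_le_sup; last by exists b.
exists K => _ [b' _ <-]; apply: (@le_trans _ _ (\tr (A a0 b' *m M))).
  by apply: ge_inf => //; exists a0.
by have := bounded a0 b'; rewrite ler_norml => /andP[].
Qed.

(** One index a serving all b makes every infimum nonpositive. *)
Lemma isaacs_operator_le0 a : inhabited IB ->
  (forall b, \tr (A a b *m M) <= 0) -> isaacs_operator A M <= 0.
Proof.
move=> [b0] Aa; apply: ge_sup; first by exists (g b0), b0.
move=> _ [b _ <-]; apply: le_trans (Aa b).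
by apply: ge_inf => //; exists a.
Qed.

End Isaacs.

(** * The Hessian of the solution tested against a coefficient matrix *)

Section HessianForm.
Variables (R : realType) (delta : R).
Implicit Types (x v y : 'rV[R]_12).
Let m := 1 + delta.

(** The cubic form is harmonic, and the other terms contribute - 6 m - 12 m + m (m + 2) = - m (16 -
    m). *)
Lemma sum_hform x : x != 0 ->
  \sum_i hform delta x (delta_mx 0 i) = - (m * (16 - m)) * (cub x / dotv x x).
Proof.
move=> x0; have S0 : dotv x x != 0 by rewrite dotv_eq0.
(* Each monomial takes one coordinate from each block, so no coordinate occurs squared. *)
have d0 i : dcub (delta_mx 0 i) x = 0.
  rewrite /dcub /qtri/= !mxE -!val_eqE/= !inordK//.
  by case: i => -[|[|[|[|[|[|[|[|[|[|[|[|//]]]]]]]]]]]] ?/=; ring.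
have d1 : \sum_i dcub x (delta_mx 0 i) * x 0 i = 3 * cub x.
  have dx0 : dcub x 0 = 0 by rewrite -(scale0r (0 : 'rV[R]_12)) dcubZr mul0r.
  (* Euler's relation, expanded in the standard basis. *)
  rewrite -dcubxx [X in _ = dcub _ X]row_sum_delta (big_morph (dcub x)
    (@dcubDr _ x) dx0).
  by apply: eq_bigr => i _; rewrite dcubZr mulrC.
pose k := cub x / dotv x x.
transitivity (\sum_i (- 2 * m / dotv x x * (dcub x (delta_mx 0 i) * x 0 i)
   - m * k + m * (m + 2) * k / dotv x x * (x 0 i * x 0 i))).
  apply: eq_bigr => i _; rewrite /hform d0 !dotv_delta mxE !eqxx/= /k -/m.
  by field.
rewrite !big_split/= -!mulr_sumr d1 -/(dotv x x) sumr_const card_ord /k.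
by rewrite -mulr_natr; field.
Qed.

(* The weight eps is chosen so that the total trace vanishes exactly when
   sum dcub v x = cub x / |x|^2. *)
Lemma weighted_hform x (vs : seq 'rV[R]_12) : 0 <= delta < 1 -> x != 0 ->
  {in vs, forall v, dotv v x = 0} -> \sum_(v <- vs) dotv v v = 1 ->
  (2 - m) / (m * (16 - m)) * (\sum_i hform delta x (delta_mx 0 i))
    + \sum_(v <- vs) hform delta x v
  = 2 * (\sum_(v <- vs) dcub v x - cub x / dotv x x).
Proof.
move=> /andP[delta0 delta1] x0 vx vs1;
  have S0 : dotv x x != 0 by rewrite dotv_eq0.
have m0 : m != 0 by rewrite /m gt_eqF//; lra.
have m16 : 16 - m != 0 by rewrite /m gt_eqF//; lra.
have -> : \sum_(v <- vs) hform delta x v =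
    \sum_(v <- vs) (2 * dcub v x - m * (cub x / dotv x x) * dotv v v).
  rewrite big_seq [RHS]big_seq; apply: eq_bigr => v /vx vx0.
  by rewrite /hform (dotvC x) vx0 -/m; field.
rewrite sumrB -!mulr_sumr vs1 sum_hform//.
by field; rewrite S0 m16.
Qed.

End HessianForm.

Theorem theorem1p2 (R : realType) (delta : R) (hdelta : 0 <= delta < 1) :
  exists F : 'M[R]_12 -> R,
    uniformly_elliptic_isaacs F
    /\ viscosity_solution F (@unit_ball R 12) (w_delta delta).
Proof.
pose m := 1 + delta; pose eps := (2 - m) / (m * (16 - m)).
have eps0 : 0 < eps.
  by move: hdelta => /andP[d0 d1]; rewrite /eps /m divr_gt0 ?mulr_gt0//; lra.
have /choice[vs vsP] (xy : 'rV[R]_12 * 'rV[R]_12) : exists vs : seq 'rV[R]_12,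
    [/\ \sum_(v <- vs) dotv v v = 1,
      xy.1 != 0 -> {in vs, forall v, dotv v xy.1 = 0} /\
        \sum_(v <- vs) dcub v xy.1 <= cub xy.1 / dotv xy.1 xy.1 &
      xy.2 != 0 -> {in vs, forall v, dotv v xy.2 = 0} /\
        cub xy.2 / dotv xy.2 xy.2 <= \sum_(v <- vs) dcub v xy.2].
  case: xy => x y /=.
  (* A zero point imposes no condition: the frame is then built from the other point taken twice, or
     is any unit vector when both vanish. *)
  have [x0|x0] := eqVneq x 0; have [y0|y0] := eqVneq y 0.
  - exists [:: delta_mx 0 0]; split=> //.
    by rewrite big_seq1 dotv_delta mxE !eqxx.
  - have [vs [vs0 vs1 vsx vsy]] := exists_pair_frame y0 y0; exists vs.
    by split=> // _; split=> // v /vs0[].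
  - have [vs [vs0 vs1 vsx vsy]] := exists_pair_frame x0 x0; exists vs.
    by split=> // _; split=> // v /vs0[].
  - have [vs [vs0 vs1 vsx vsy]] := exists_pair_frame x0 y0; exists vs.
    by split=> // _; split=> // v /vs0[].
(* The infimum runs over x and the supremum over y. Fixing the second index at the contact point
   makes all traces against N nonnegative; fixing the first makes them nonpositive. *)
pose A (x y : 'rV[R]_12) := coef_mx eps (vs (x, y)).
have vs1 x y : \sum_(v <- vs (x, y)) dotv v v = 1 by case: (vsP (x, y)).
exists (isaacs_operator A); split.
  exists 'rV[R]_12, 'rV[R]_12, A, (eps^-1 + 1 + eps); split => //.
  - exact: inhabits 0.
  - exact: inhabits 0.
  - by rewrite !addr_gt0 ?invr_gt0.
  - exact: uniformly_elliptic_coef_mx.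
split; first exact/continuous_subspaceT/continuous_w_delta.
move=> x phi _ phi2.
pose M := hessian phi x.
(* This bound is uniform over the family because the squared lengths in each frame sum to 1. *)
pose K := eps * `|\sum_i qform M (delta_mx 0 i)| + \sum_i \sum_j `|M i j|.
have bounded a b : `|\tr (A a b *m M)| <= K.
  rewrite mxtrace_coef_mx; apply: (le_trans (ler_normD _ _)).
  rewrite normrM (gtr0_norm eps0) lerD2l.
  apply: (le_trans (ler_norm_sum _ _ _)).
  rewrite -[leRHS]mulr1 -(vs1 a b) mulr_sumr; apply: ler_sum => v _.
  exact: qform_bound.
have [x0|x0] := eqVneq x 0.
  rewrite x0 in phi2 M K bounded *; split => [xmax|xmin].
    (* At the origin the Hessian of the test function is semidefinite, so every coefficient matrix
       gives a trace of the right sign and the index 0 is an arbitrary choice. *)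
    apply: (isaacs_operator_ge0 bounded (b := 0)); first exact: inhabits 0.
    move=> a; rewrite mxtrace_coef_mx; have M0 := touching_above0 phi2 xmax.
    apply: addr_ge0; last by apply: sumr_ge0 => v _; exact: M0.
    by apply: mulr_ge0; [exact: ltW|apply: sumr_ge0 => i _; exact: M0].
  apply: (isaacs_operator_le0 bounded (a := 0)); first exact: inhabits 0.
  move=> a; rewrite mxtrace_coef_mx; have M0 := touching_below0 phi2 xmin.
  rewrite -[leRHS]addr0; apply: lerD; last by apply: sumr_le0 => v _; exact: M0.
  by rewrite pmulr_rle0//; apply: sumr_le0 => i _; exact: M0.
pose s := dotv x x `^ (- (m / 2)).
have s0 : 0 <= s by exact: powR_ge0.
have trE a b : {in vs (a, b), forall v, dotv v x = 0} ->
    eps * (\sum_i s * hform delta x (delta_mx 0 i))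
      + \sum_(v <- vs (a, b)) s * hform delta x v
    = s * (2 * (\sum_(v <- vs (a, b)) dcub v x - cub x / dotv x x)).
  by move=> vx; rewrite -(weighted_hform hdelta x0 vx (vs1 a b)) -!mulr_sumr
    mulrDr mulrCA.
split => [xmax|xmin].
  (* Contact from above puts the Hessian of the test function above N(x), and every frame indexed by
     (a, x) gives a nonnegative trace against N(x). *)
  apply: (isaacs_operator_ge0 bounded (b := x)); first exact: inhabits 0.
  move=> a; rewrite mxtrace_coef_mx; have M0 := touching_above x0 phi2 xmax.
  have [_ _ /(_ x0)[vx vsx]] := vsP (a, x).
  apply: (@le_trans _ _ (eps * (\sum_i s * hform delta x (delta_mx 0 i))
    + \sum_(v <- vs (a, x)) s * hform delta x v)).
    by rewrite trE// !mulr_ge0// subr_ge0.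
  by rewrite lerD ?ler_wpM2l ?(ltW eps0)// ler_sum.
apply: (isaacs_operator_le0 bounded (a := x)); first exact: inhabits 0.
move=> b; rewrite mxtrace_coef_mx; have M0 := touching_below x0 phi2 xmin.
have [_ /(_ x0)[vx vsx] _] := vsP (x, b).
apply: (@le_trans _ _ (eps * (\sum_i s * hform delta x (delta_mx 0 i))
  + \sum_(v <- vs (x, b)) s * hform delta x v)).
  by rewrite lerD ?ler_wpM2l ?(ltW eps0)// ler_sum.
by rewrite trE// !mulr_ge0_le0// subr_le0.
Qed.
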